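(* Let $Z$ be a $\mathcal{Z}$-valued random variable with probability density $f_\star$ with respect to $dz$, and write $\mathbb{P}_\star,\mathbb{E}_\star$ for probability and expectation under $f_\star$. Let $\theta_\star\in\mathbb{R}^p$, $\theta_\star\neq 0$, let $\delta_\star\in\Delta$ be the support of $\theta_\star$ and $s_\star=\|\theta_\star\|_0$. Let $\bar\rho,\bar\kappa$ be finite positive constants such that $\mathbb{P}_\star(Z\in\mathcal{E}_0)>0$, where $\mathcal{E}_0$ is the set defined in the context, and suppose $32\rho_1\|\theta_\star\|_\infty\le\bar\rho$. Suppose the prior on $\delta$ is $\omega(\delta)=\mathsf{q}^{\|\delta\|_0}(1-\mathsf{q})^{p-\|\delta\|_0}$, $\delta\in\Delta$, where $\mathsf{q}\in(0,1)$ satisfies $\frac{\mathsf{q}}{1-\mathsf{q}}=\frac{1}{p^{u+1}}$ for some absolute constant $u>0$, and that $p\ge 9$ and $p^{u/2}\ge 2e^{2\rho_1}$. Let $\bar s\ge s_\star$ be an arbitrary integer, let $\mathsf{r}$ be a rate function, let $\mathcal{E}_1(\bar s)$, $\epsilon$ and $\mathsf{B}$ be the associated objects defined in the context (with absolute constants $C,C_1\ge3$), and let $\mathcal{E}\subseteq\mathcal{E}_1(\bar s)$ be measurable. If $$C\bar\rho(s_\star+\bar s)^{1/2}\epsilon\ \ge\ 32\max\left[\bar s\log(p),\ (1+u)s_\star\log\left(p+\frac{p\bar\kappa}{\rho_1}\right)\right],$$ then for all $p$ large enough, $$\mathbb{E}_\star\left[\mathbf{1}_{\mathcal{E}}(Z)\,\Pi(\mathsf{B}^c\mid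 Z)\right]\le\mathbb{E}_\star\left[\mathbf{1}_{\mathcal{E}}(Z)\,\Pi(\|\delta\|_0>\bar s\mid Z)\right]+8e^{-\frac{C}{32}\bar\rho(s_\star+\bar s)^{1/2}\epsilon}+2e^{-p},$$ where $\mathsf{B}^c=(\Delta\times\mathbb{R}^p)\setminus\mathsf{B}$.
   Context: Setting: $\mathcal{Z}$ is a measurable space with a sigma-finite reference measure $dz$; $\ell:\mathbb{R}^p\times\mathcal{Z}\to\mathbb{R}$ is jointly measurable and thrice differentiable in its first argument for every $z$; $\nabla$ denotes differentiation with respect to the first argument. $\rho_0,\rho_1>0$ are prior parameters. An absolute constant is one that does not depend on $p$; all other quantities may depend on $p$, and asymptotics are as $p\to\infty$. Notation: $\Delta=\{0,1\}^p$; $\theta\cdot\theta'$ is the componentwise product; $\theta_\delta=\theta\cdot\delta$; $\mathbb{R}^p_\delta=\{\theta\cdot\delta:\theta\in\mathbb{R}^p\}$; $\|\cdot\|_0$ is the number of nonzero components; $\Delta_{\bar s}=\{\delta\in\Delta:\|\delta\|_0\le\bar s\}$. Quasi-posterior distribution on $\Delta\times\mathbb{R}^p$: $$\Pi(\delta,d\theta\mid z)\propto e^{\ell(\theta_\delta;z)}\,\omega(\delta)\left(\tfrac{\rho_1}{2\pi}\right)^{\|\delta\|_0/2}\left(\tfrac{\rho_0}{2\pi}\right)^{(p-\|\delta\|_0)/2}e^{-\frac{\rho_1}{2}\|\theta_\delta\|_2^2}e^{-\frac{\rho_0}{2}\|\theta-\theta_\delta\|_2^2}\,d\theta ,$$ well-defined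 when it can be normalized. $\mathcal{L}_{\theta_1}(\theta;z)=\ell(\theta;z)-\ell(\theta_1;z)-\langle\nabla\ell(\theta_1;z),\theta-\theta_1\rangle$. $\mathcal{E}_0=\{z\in\mathcal{Z}:\ \Pi(\cdot\mid z)\text{ is well-defined},\ \|\nabla\ell(\theta_\star;z)\|_\infty\le\bar\rho/2,\ \text{and }\mathcal{L}_{\theta_\star}(\theta;z)\ge-\frac{\bar\kappa}{2}\|\theta-\theta_\star\|_2^2\text{ for all }\theta\in\mathbb{R}^p_{\delta_\star}\}$. A rate function is a continuous increasing function $\mathsf{r}:[0,\infty)\to[0,\infty)$ with $\mathsf{r}(0)=0$ and $\lim_{x\downarrow0}\mathsf{r}(x)/x=0$. Given a rate function $\mathsf{r}$, $$\mathcal{E}_1(\bar s)=\mathcal{E}_0\cap\left\{z\in\mathcal{Z}:\ \mathcal{L}_{\theta_\star}(\theta;z)\le-\tfrac12\mathsf{r}(\|\theta-\theta_\star\|_2)\ \text{for all }\delta\in\Delta_{\bar s},\ \theta\in\mathbb{R}^p_\delta\right\},$$ $$\epsilon=\inf\left\{y>0:\ \mathsf{r}(x)-2(s_\star+\bar s)^{1/2}\bar\rho\,x\ge0\ \text{for all }x\ge y\right\}.$$ For some absolute constants $C,C_1\ge3$: $\mathsf{B}^{(\delta)}=\{\theta\in\mathbb{R}^p:\ \|\theta_\delta-\theta_\star\|_2\le C\epsilon,\ \|\theta-\theta_\delta\|_2\le\sqrt{(1+C_1)\rho_0^{-1}p}\}$ and $\mathsf{B}=\bigcup_{\delta\in\Delta_{\bar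 s}}\{\delta\}\times\mathsf{B}^{(\delta)}$. *)

(* Defs.v *)
From HB Require Import structures.
From mathcomp Require Import all_boot all_order all_algebra.
From mathcomp Require Import all_classical all_reals all_analysis.

Set Implicit Arguments.
Unset Strict Implicit.
Unset Printing Implicit Defensive.

Import Order.TTheory GRing.Theory Num.Theory.
Import numFieldNormedType.Exports.

Local Open Scope classical_set_scope.
Local Open Scope ring_scope.

(* Lebesgue measure on R^n, by recursion on n: the unit mass on the only       *)
(* 0-tuple, then the image of the product measure under (x, t) |-> x :: t.     *)
(* The sigma-algebra on tuples is the one generated by the coordinates, i.e.   *)
(* the Borel sigma-algebra of R^n.                                             *)
Section lebesgue_tuple.
Context (R : realType).
Local Notation Rn n := (n.-tuple (measurableTypeR R)).

Definition tuple_cons n (xt : measurableTypeR R * Rn n) : Rn n.+1 :=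
  [tuple of xt.1 :: xt.2].

Lemma measurable_tuple_cons n : measurable_fun [set: _] (@tuple_cons n).
Proof.
exact: (@measurable_cons _ _ _ _ fst n snd measurable_fst measurable_snd).
Qed.

HB.instance Definition _ n :=
  isMeasurableFun.Build _ _ _ _ (@tuple_cons n) (@measurable_tuple_cons n).

Section succ.
Context n (m : {sigma_finite_measure set Rn n -> \bar R}).

Definition lebesgue_tupleS : set (Rn n.+1) -> \bar R :=
  pushforward (lebesgue_measure \x m)%E (@tuple_cons n).

Let lebesgue_tupleS0 : lebesgue_tupleS set0 = 0%E.
Proof. exact: measure0. Qed.

Let lebesgue_tupleS_ge0 A : (0 <= lebesgue_tupleS A)%E.
Proof. exact: measure_ge0. Qed.

Let lebesgue_tupleS_sigma_additive : semi_sigma_additive lebesgue_tupleS.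
Proof.
move=> F mF tF mUF; rewrite /lebesgue_tupleS /pushforward preimage_bigcup.
apply: measure_semi_sigma_additive.
- by move=> k; rewrite -[X in measurable X]setTI; exact: measurable_tuple_cons.
- apply/trivIsetP => /= i j _ _ ij; rewrite -preimage_setI.
  by move/trivIsetP : tF => /(_ _ _ _ _ ij) ->//; rewrite preimage_set0.
- rewrite -preimage_bigcup -[X in measurable X]setTI.
  exact: measurable_tuple_cons.
Qed.

HB.instance Definition _ := isMeasure.Build _ _ _ lebesgue_tupleS
  lebesgue_tupleS0 lebesgue_tupleS_ge0 lebesgue_tupleS_sigma_additive.

Let sigma_finite_lebesgue_tupleS : sigma_finite setT lebesgue_tupleS.
Proof.
pose uncons (t : Rn n.+1) : measurableTypeR R * Rn n :=
  (thead t, [tuple of behead t]).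
have consK : cancel (@tuple_cons n) uncons.
  by move=> [x t]; congr pair; apply/val_inj.
have unconsK : cancel uncons (@tuple_cons n).
  by move=> t; rewrite [RHS]tuple_eta; apply/val_inj.
have muncons : measurable_fun [set: Rn n.+1] uncons.
  apply/measurable_fun_pairP; split.
    exact: measurable_tnth.
  exact: measurable_behead.
have /sigma_finiteP[F [TF ndF Foo]] := @sigma_finiteT _ _ R lebesgue_measure.
have /sigma_finiteP[G [TG ndG Goo]] := sigma_finiteT m.
exists (fun k => uncons @^-1` (F k `*` G k)).
  rewrite -preimage_bigcup (_ : \bigcup_k _ = setT) ?preimage_setT//.
  rewrite -setXTT TF TG predeqE => -[x y]; split.
    by move=> [k _ []/= ? ?]; split; exists k.
  move=> [/= [k _ Fkx] [l _ Gly]]; exists (maxn k l) => //; split.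
  - by move: x Fkx; exact/subsetPset/ndF/leq_maxl.
  - by move: y Gly; exact/subsetPset/ndG/leq_maxr.
move=> k; have [? ?] := Foo k; have [? ?] := Goo k; split.
  by rewrite -[X in measurable X]setTI; apply: muncons => //; exact: measurableX.
rewrite /lebesgue_tupleS /pushforward -comp_preimage.
rewrite (_ : uncons \o _ = id) ?preimage_id; last exact/funext.
by rewrite product_measure1E// lte_mul_pinfty// ge0_fin_numE.
Qed.

HB.instance Definition _ := Measure_isSigmaFinite.Build _ _ _ lebesgue_tupleS
  sigma_finite_lebesgue_tupleS.

End succ.

Fixpoint lebesgue_tuple n : {sigma_finite_measure set Rn n -> \bar R} :=
  match n with
  | 0 => [the {sigma_finite_measure set Rn 0 -> \bar R} of
            dirac ([tuple] : Rn 0)]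
  | n'.+1 => [the {sigma_finite_measure set Rn n'.+1 -> \bar R} of
            lebesgue_tupleS (lebesgue_tuple n')]
  end.

End lebesgue_tuple.

Section sparse_vectors.
Context (R : realType) (p : nat).
Implicit Types (theta : 'rV[R]_p) (delta : {ffun 'I_p -> bool}).

(* theta |-> theta_delta *)
Definition vmask delta theta : 'rV[R]_p := \row_i (theta 0 i * (delta i)%:R).

(* R^p_delta *)
Definition vmask_space delta : set 'rV[R]_p := range (vmask delta).

Definition vsupport theta : {ffun 'I_p -> bool} := [ffun i => theta 0 i != 0].

Definition l0norm theta : nat := #|[pred i | theta 0 i != 0]|.

Definition dl0norm delta : nat := #|[pred i | delta i]|.

Definition dotv theta theta' : R := \sum_(i < p) theta 0 i * theta' 0 i.

Definition l2norm theta : R := Num.sqrt (\sum_(i < p) theta 0 i ^+ 2).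

Definition linfnorm theta : R := \big[Num.max/0]_(i < p) `|theta 0 i|.

Definition grad (f : 'rV[R]_p -> R) theta : 'rV[R]_p :=
  \row_i 'D_(delta_mx 0 i) f theta.

(* In finite dimension, f is k.+1 times (Frechet) differentiable iff it is     *)
(* differentiable and all its directional derivatives are k times so.          *)
Fixpoint times_differentiable (k : nat) (f : 'rV[R]_p -> R) : Prop :=
  if k is k'.+1 then
    (forall theta, differentiable f theta) /\
    (forall v : 'rV[R]_p, times_differentiable k' ('D_v f))
  else True.

Definition row_of_tuple (t : p.-tuple (measurableTypeR R)) : 'rV[R]_p :=
  \row_i tnth t i.

End sparse_vectors.

Definition bernoulli_prior (R : realType) (p : nat) (q : R)
    (delta : {ffun 'I_p -> bool}) : R :=
  q ^+ dl0norm delta * (1 - q) ^+ (p - dl0norm delta).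

Section quasi_posterior.
Context (R : realType) (p : nat) (d : measure_display) (Zs : measurableType d).
Context (ell : 'rV[R]_p -> Zs -> R).
Context (rho0 rho1 : R) (omega : {ffun 'I_p -> bool} -> R).
Implicit Types (z : Zs) (delta : {ffun 'I_p -> bool}) (theta : 'rV[R]_p).
Implicit Types A : set ({ffun 'I_p -> bool} * 'rV[R]_p).

Definition quasi_density z delta theta : R :=
  expR (ell (vmask delta theta) z) * omega delta *
  (rho1 / (2 * pi)) `^ ((dl0norm delta)%:R / 2) *
  (rho0 / (2 * pi)) `^ ((p - dl0norm delta)%:R / 2) *
  expR (- (rho1 / 2) * l2norm (vmask delta theta) ^+ 2) *
  expR (- (rho0 / 2) * l2norm (theta - vmask delta theta) ^+ 2).

Definition quasi_mass z A : \bar R :=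
  (\sum_(delta : {ffun 'I_p -> bool})
     \int[@lebesgue_tuple R p]_(t in [set t | A (delta, row_of_tuple t)])
       (quasi_density z delta (row_of_tuple t))%:E)%E.

Definition quasi_well_defined z : Prop := (0 < quasi_mass z setT < +oo)%E.

(* Pi(A | z); the value is meaningful only when quasi_well_defined z *)
Definition quasi_posterior z A : R :=
  fine (quasi_mass z A) / fine (quasi_mass z setT).

End quasi_posterior.

Section events.
Context (R : realType) (p : nat) (d : measure_display) (Zs : measurableType d).
Context (ell : 'rV[R]_p -> Zs -> R).

(* calL_(theta1)(theta; z) *)
Definition bregman (theta1 theta : 'rV[R]_p) (z : Zs) : R :=
  ell theta z - ell theta1 z - dotv (grad (ell^~ z) theta1) (theta - theta1).

Definition event0 (rho0 rho1 : R) (omega : {ffun 'I_p -> bool} -> R)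
    (thetas : 'rV[R]_p) (rhob kappab : R) : set Zs :=
  [set z | [/\ quasi_well_defined ell rho0 rho1 omega z,
    linfnorm (grad (ell^~ z) thetas) <= rhob / 2 &
    forall theta, vmask_space (vsupport thetas) theta ->
      - (kappab / 2) * l2norm (theta - thetas) ^+ 2
        <= bregman thetas theta z]].

Definition event1 (rho0 rho1 : R) (omega : {ffun 'I_p -> bool} -> R)
    (thetas : 'rV[R]_p) (rhob kappab : R) (r : R -> R) (sbar : nat) : set Zs :=
  event0 rho0 rho1 omega thetas rhob kappab `&`
  [set z | forall (delta : {ffun 'I_p -> bool}) (theta : 'rV[R]_p),
    (dl0norm delta <= sbar)%N -> vmask_space delta theta ->
    bregman thetas theta z <= - (1 / 2) * r (l2norm (theta - thetas))].

End events.

(* Only the restriction of r to [0, +oo[ matters. *)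
Definition rate_function (R : realType) (r : R -> R) : Prop :=
  [/\ forall x, 0 <= x -> 0 <= r x,
      {within `[0, +oo[, continuous r},
      forall x y, 0 <= x -> x <= y -> r x <= r y,
      r 0 = 0 &
      r x / x @[x --> 0^'+] --> (0 : R)].

(* The infimum is taken in the extended reals: it is +oo when the set is       *)
(* empty.                                                                      *)
Definition contraction_radius (R : realType) (r : R -> R) (rhob : R)
    (sstar sbar : nat) : \bar R :=
  ereal_inf [set y%:E | y in [set y : R | 0 < y /\ forall x, y <= x ->
    0 <= r x - 2 * Num.sqrt (sstar + sbar)%:R * rhob * x]].

Section contraction_set.
Context (R : realType) (p : nat).

Definition Bdelta (C C1 rho0 : R) (eps : \bar R) (thetas : 'rV[R]_p)
    (delta : {ffun 'I_p -> bool}) : set 'rV[R]_p :=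
  [set theta |
    ((l2norm (vmask delta theta - thetas))%:E <= C%:E * eps)%E /\
    l2norm (theta - vmask delta theta)
      <= Num.sqrt ((1 + C1) * rho0^-1 * p%:R)].

Definition Bset (C C1 rho0 : R) (eps : \bar R) (thetas : 'rV[R]_p)
    (sbar : nat) : set ({ffun 'I_p -> bool} * 'rV[R]_p) :=
  \bigcup_(delta in [set delta | (dl0norm delta <= sbar)%N])
    ([set delta] `*` Bdelta C C1 rho0 eps thetas delta).

End contraction_set.

(* Main.v *)
Require Import Defs.
From HB Require Import structures.
From mathcomp Require Import all_boot all_order all_algebra.
From mathcomp Require Import all_classical all_reals all_analysis.
From mathcomp Require Import measurable_realfun ring lra.

Set Implicit Arguments.
Unset Strict Implicit.
Unset Printing Implicit Defensive.

Import Order.TTheory GRing.Theory Num.Theory.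
Import numFieldNormedType.Exports.

Local Open Scope classical_set_scope.
Local Open Scope ring_scope.

(** The bound holds for each observation [z] in [E] separately, and since its
    last two terms do not depend on [z], integrating it is immediate
    ([expectation_le_add]).

    Fix such a [z].  The complement of the contraction set has three parts.
    Models with more than [sbar] active coordinates are the first term of the
    bound.  In a model [delta] with at most [sbar] active coordinates, either
    the inactive part [theta - theta_delta] is too long, or [theta_delta] is
    too far from [thetas].

    The inactive part is, conditionally on [delta] and [theta_delta], a
    Gaussian vector with independent coordinates of precision [rho0].  Tilting
    its density by [exp (rho0 / 4 * |x|^2)] multiplies its mass by at most
    [2^(p / 2)], while the tilt is at least [exp ((1 + C1) * p / 4)] where the
    vector is too long.  As soon as [C1 >= 7], that region thus carries at most
    a fraction [exp (- p)] of the total mass ([integral_density_tilt],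
    [quasi_slice_le]).

    For [theta_delta] at distance [x > C * eps] from [thetas], put
    [a := rhob * sqrt (sstar + sbar)].  The gradient contributes at most
    [a * x / 2] to the log-likelihood ratio, because the difference has at most
    [sstar + sbar] nonzero coordinates; the Bregman term contributes at most
    [- r x / 2 <= - a * x], by the definition of [eps]; recentring the slab at
    [thetas] costs at most [a * x / 32].  So up to the factor
    [exp (- 15/32 * a * x)] the quasi-density is below a product of Gaussian
    densities, whose mass is one ([quasi_density_far]).

    The normalizing constant is at least the mass of the true model, where the
    curvature condition gives a Gaussian lower bound after completing the
    square coordinatewise ([quasi_density_lower], [quasi_mass_ge]).  The ratio
    of the two bounds contains the inverse prior weight of the true model, about
    [p^((1 + u) * sstar)], and the factor [(1 + kappab / rho1)^(sstar / 2)]; the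
    assumed lower bound on [C * a * eps] says that both are absorbed by a small
    fraction of the exponent ([far_weight_le]).

    The pointwise estimate is proved with an arbitrary real [y <= C * eps] in
    place of [C * eps] ([quasi_posterior_setCB_le]), so that an infinite [eps]
    is covered by a large enough [y]: the exponential term, then absent from
    the claim, is made smaller than the second of the two terms
    [exp (- p)]. *)

(** * Integration on R^n coordinate by coordinate *)

Section lebesgue_tuple_integral.
Context (R : realType).
Local Notation mR := (measurableTypeR R).

Lemma integral_lebesgue_tupleS n (f : n.+1.-tuple mR -> \bar R) :
  measurable_fun [set: n.+1.-tuple mR] f -> (forall t, 0 <= f t)%E ->
  (\int[lebesgue_tuple R n.+1]_t f t =
   \int[lebesgue_measure]_x \int[lebesgue_tuple R n]_t f (tuple_cons (x, t)))%E.
Proof.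
move=> mf f0.
rewrite (@ge0_integral_pushforward _ _ _ _ R (@tuple_cons R n))//.
rewrite preimage_setT.
rewrite (@fubini_tonelli1 _ _ _ _ _ lebesgue_measure (lebesgue_tuple R n))//.
  by apply: measurableT_comp => //; exact: measurable_tuple_cons.
by move=> x; exact: f0.
Qed.

Lemma tnth_tuple_cons0 n (x : mR) (t : n.-tuple mR) :
  tnth (tuple_cons (x, t)) ord0 = x.
Proof. by []. Qed.

Lemma tnth_tuple_consS n (x : mR) (t : n.-tuple mR) (i : 'I_n) :
  tnth (tuple_cons (x, t)) (lift ord0 i) = tnth t i.
Proof. by rewrite tnthS. Qed.

Lemma measurable_tuple_cons1 n (x : mR) :
  measurable_fun [set: n.-tuple mR] (fun t => tuple_cons (x, t)).
Proof.
apply: (measurableT_comp (@measurable_tuple_cons R n)).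
exact: pair1_measurable.
Qed.

Definition prob_density (g : mR -> R) :=
  [/\ measurable_fun setT g, forall x, 0 <= g x &
      (\int[lebesgue_measure]_x (g x)%:E = 1)%E].

Lemma measurable_density g : prob_density g -> measurable_fun setT g.
Proof. by case. Qed.

Lemma measurable_prod_coord n (g : 'I_n -> mR -> R) :
  (forall i, measurable_fun setT (g i)) ->
  measurable_fun [set: n.-tuple mR] (fun t => \prod_(i < n) g i (tnth t i)).
Proof.
move=> mg; apply: measurable_prod => i _.
by apply: measurableT_comp => //; exact: measurable_tnth.
Qed.

Lemma integral_prod_density n (g : 'I_n -> mR -> R) :
  (forall i, prob_density (g i)) ->
  (\int[lebesgue_tuple R n]_t (\prod_(i < n) g i (tnth t i))%:E = 1)%E.
Proof.
elim: n g => [|n IH] g hg.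
  under eq_integral do rewrite big_ord0.
  by rewrite integral_cst//= diracT mule1.
have [mg0 g0 ig0] := hg ord0.
rewrite integral_lebesgue_tupleS; last 2 first.
- apply/measurable_EFinP; apply: (@measurable_prod_coord _ g) => i.
  exact: measurable_density.
- by move=> t; rewrite lee_fin prodr_ge0// => i _; case: (hg i).
rewrite -[RHS]ig0; apply: eq_integral => x _.
under eq_integral.
  move=> t _; rewrite big_ord_recl tnth_tuple_cons0 EFinM.
  under eq_bigr do rewrite tnth_tuple_consS.
  over.
rewrite ge0_integralZl ?lee_fin//; last 2 first.
- apply/measurable_EFinP.
  apply: (@measurable_prod_coord _ (fun i => g (lift ord0 i))) => i.
  exact: measurable_density.
- by move=> t _; rewrite lee_fin prodr_ge0// => i _; case: (hg (lift ord0 i)).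
by rewrite (IH (fun i => g (lift ord0 i))) ?mule1// => i; exact: hg.
Qed.

(** Stated through equality of values, rather than as factoring through a
    projection, so that it passes to [fun t => F (x :: t)] in inductions on the
    dimension. *)
Definition ignores_outside n (b : 'I_n -> bool) (F : n.-tuple mR -> R) :=
  forall t t', (forall i, b i -> tnth t i = tnth t' i) -> F t = F t'.

(** Both sides are the integral of [F] over the coordinates in [b], the others
    having been integrated out: this lets a conditional density be replaced
    without naming the lower-dimensional space of the active coordinates. *)
Lemma integral_swap_density n (b : 'I_n -> bool) (F : n.-tuple mR -> R)
    (g h : 'I_n -> mR -> R) :
  measurable_fun [set: n.-tuple mR] F -> (forall t, 0 <= F t) ->
  ignores_outside b F ->
  (forall i, prob_density (g i)) -> (forall i, prob_density (h i)) ->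
  (\int[lebesgue_tuple R n]_t
     (F t * \prod_(i < n | ~~ b i) g i (tnth t i))%:E =
   \int[lebesgue_tuple R n]_t
     (F t * \prod_(i < n | ~~ b i) h i (tnth t i))%:E)%E.
Proof.
elim: n b F g h => [|n IH] b F g h mF F0 bF hg hh.
  by apply: eq_integral => t _; rewrite !big_ord0.
have mP (k : 'I_n.+1 -> mR -> R) : (forall i, prob_density (k i)) ->
    measurable_fun [set: n.+1.-tuple mR]
    (fun t => (F t * \prod_(i < n.+1 | ~~ b i) k i (tnth t i))%:E).
  move=> hk; apply/measurable_EFinP; apply: measurable_funM => //.
  under eq_fun do rewrite big_mkcond.
  apply: (@measurable_prod_coord _ (fun i x => if ~~ b i then k i x else 1)).
  by move=> i; case: (~~ b i) => //; exact: measurable_density.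
have P0 (k : 'I_n.+1 -> mR -> R) : (forall i, prob_density (k i)) -> 
    forall t : n.+1.-tuple mR,
    (0 <= (F t * \prod_(i < n.+1 | ~~ b i) k i (tnth t i))%:E)%E.
  by move=> hk t; rewrite lee_fin mulr_ge0// prodr_ge0// => i _; case: (hk i).
rewrite (integral_lebesgue_tupleS (mP g hg) (P0 g hg)).
rewrite (integral_lebesgue_tupleS (mP h hh) (P0 h hh)).
pose b' i := b (lift ord0 i).
have IHx x : 
    (\int[lebesgue_tuple R n]_t (F (tuple_cons (x, t)) *
       \prod_(i < n | ~~ b' i) g (lift ord0 i) (tnth t i))%:E =
     \int[lebesgue_tuple R n]_t (F (tuple_cons (x, t)) *
       \prod_(i < n | ~~ b' i) h (lift ord0 i) (tnth t i))%:E)%E.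
  apply: (IH b' (fun t => F (tuple_cons (x, t))) (fun i => g (lift ord0 i))
    (fun i => h (lift ord0 i))) => //.
  - by apply: measurableT_comp => //; exact: measurable_tuple_cons1.
  - move=> t t' tt'; apply: bF => i; case: (unliftP ord0 i) => [j ->|->] bi.
      by rewrite !tnth_tuple_consS; exact: tt'.
    by rewrite !tnth_tuple_cons0.
have step (k : 'I_n.+1 -> mR -> R) (x : mR) (t : n.-tuple mR) :
    \prod_(i < n.+1 | ~~ b i) k i (tnth (tuple_cons (x, t)) i) =
    (if b ord0 then 1 else k ord0 x) *
      \prod_(i < n | ~~ b' i) k (lift ord0 i) (tnth t i).
  rewrite big_mkcond big_ord_recl tnth_tuple_cons0 -big_mkcond /= if_neg.
  by congr (_ * _); apply: eq_bigr => i _; rewrite tnth_tuple_consS.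
have [b0|b0] := boolP (b ord0).
  apply: eq_integral => x _.
  under eq_integral do rewrite step b0 mul1r.
  under [RHS]eq_integral do rewrite step b0 mul1r.
  exact: IHx.
(* The first coordinate is integrated out, with [F] frozen at value 0 there. *)
have Fx0 x t : F (tuple_cons (x, t)) = F (tuple_cons (0, t)).
  apply: bF => i; case: (unliftP ord0 i) => [j ->|->] bi.
    by rewrite !tnth_tuple_consS.
  by rewrite bi in b0.
have fact (k : 'I_n.+1 -> mR -> R) : (forall i, prob_density (k i)) ->
   (\int[lebesgue_measure]_x \int[lebesgue_tuple R n]_t
      (F (tuple_cons (x, t)) *
       \prod_(i < n.+1 | ~~ b i) k i (tnth (tuple_cons (x, t)) i))%:E =
    \int[lebesgue_tuple R n]_t (F (tuple_cons (0%R, t)) *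
       \prod_(i < n | ~~ b' i) k (lift ord0 i) (tnth t i))%:E)%E.
  move=> hk; have [mk0 k0 ik0] := hk ord0.
  set I := RHS.
  transitivity (\int[lebesgue_measure]_x ((k ord0 x)%:E * I))%E.
    apply: eq_integral => x _.
    under eq_integral do rewrite step (negbTE b0) Fx0 mulrCA EFinM.
    rewrite ge0_integralZl ?lee_fin//.
    - apply/measurable_EFinP; apply: measurable_funM.
        by apply: measurableT_comp => //; exact: measurable_tuple_cons1.
      under eq_fun do rewrite big_mkcond.
      apply: (@measurable_prod_coord _
        (fun i x => if ~~ b' i then k (lift ord0 i) x else 1)).
      by move=> i; case: (~~ b' i) => //; exact: measurable_density.
    - move=> t _; rewrite lee_fin mulr_ge0// prodr_ge0// => i _.
      by case: (hk (lift ord0 i)).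
  rewrite ge0_integralZr//.
  - by rewrite ik0 mul1e.
  - exact/measurable_EFinP.
  - by move=> x _; rewrite lee_fin.
  - rewrite /I; apply: integral_ge0 => t _.
    rewrite lee_fin mulr_ge0// prodr_ge0// => i _.
    by case: (hk (lift ord0 i)).
by rewrite !fact// IHx.
Qed.

End lebesgue_tuple_integral.

(** * Gaussian densities *)

Section gaussian.
Context (R : realType).

(** The normal density of mean [m], parametrized by its precision [rho], as the
    spike and the slab are. *)
Definition gauss_density (rho m x : R) : R :=
  Num.sqrt (rho / (2 * pi)) * expR (- (rho / 2) * (x - m) ^+ 2).

Lemma gauss_densityE (rho m : R) : 0 < rho ->
  gauss_density rho m = normal_pdf m (Num.sqrt rho)^-1.
Proof.
move=> rho0; apply/funext => x.
have s0 : Num.sqrt rho != 0 by rewrite gt_eqF// sqrtr_gt0.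
rewrite normal_pdfE ?invr_eq0// /gauss_density /normal_peak /normal_fun.
have -> : (Num.sqrt rho)^-1 ^+ 2 = rho^-1.
  by rewrite exprVn sqr_sqrtr// ltW.
congr (_ * expR _).
  rewrite -sqrtrV; last first.
    by rewrite mulrn_wge0// mulr_ge0// ?pi_ge0// invr_ge0 ltW.
  have := pi_gt0 R; move: (pi : R) => P P0.
  by congr Num.sqrt; field; rewrite !gt_eqF.
by field; rewrite gt_eqF.
Qed.

Lemma prob_density_gauss (rho m : R) : 0 < rho ->
  prob_density (gauss_density rho m).
Proof.
move=> rho0; rewrite gauss_densityE//; split.
- exact: measurable_normal_pdf.
- by move=> x; exact: normal_pdf_ge0.
- exact: integral_normal_pdf.
Qed.

End gaussian.

(** * The quasi-density as a product over coordinates *)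

Section product_form.
Context (R : realType) (p : nat).
Implicit Types (delta : {ffun 'I_p -> bool}) (theta : 'rV[R]_p).
Local Notation Rp := (p.-tuple (measurableTypeR R)).

Lemma dl0normC delta : (p - dl0norm delta)%N = #|[pred i | ~~ delta i]|.
Proof.
have := cardC [pred i | delta i]; rewrite card_ord => {1}<-.
by rewrite addKn; apply: eq_card.
Qed.

Lemma prod_select delta (a b : R) :
  \prod_i (if delta i then a else b) =
  a ^+ dl0norm delta * b ^+ (p - dl0norm delta).
Proof.
rewrite (bigID [pred i | delta i])/= dl0normC -!prodr_const; congr (_ * _).
  by apply: eq_bigr => i /= ->.
by apply: eq_bigr => i /= /negbTE ->.
Qed.

Lemma sqr_l2norm theta : l2norm theta ^+ 2 = \sum_(i < p) theta 0 i ^+ 2.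
Proof. by rewrite sqr_sqrtr// sumr_ge0// => i _; exact: sqr_ge0. Qed.

Lemma l2norm_ge0 theta : 0 <= l2norm theta. Proof. exact: sqrtr_ge0. Qed.

Lemma powR_half (a : R) (n : nat) : 0 <= a ->
  a `^ (n%:R / 2) = Num.sqrt a ^+ n.
Proof.
by move=> a0; rewrite mulrC powRrM powR12_sqrt// powR_mulrn// sqrtr_ge0.
Qed.

Lemma prod_gauss_density (rho m x : 'I_p -> R) :
  \prod_i gauss_density (rho i) (m i) (x i) =
  (\prod_i Num.sqrt (rho i / (2 * pi))) *
    expR (\sum_i - (rho i / 2) * (x i - m i) ^+ 2).
Proof. by rewrite expR_sum -big_split. Qed.

Definition tuple_mask delta (t : Rp) : Rp :=
  [tuple tnth t i * (delta i)%:R | i < p].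

Lemma vmask_row_of_tuple delta (t : Rp) :
  vmask delta (row_of_tuple t) = row_of_tuple (tuple_mask delta t).
Proof. by apply/rowP => i; rewrite !mxE tnth_mktuple. Qed.

Lemma measurable_tuple_mask delta :
  measurable_fun [set: Rp] (tuple_mask delta).
Proof.
apply/measurable_fun_tnthP => i.
rewrite (_ : _ \o _ = fun t : Rp => tnth t i * (delta i)%:R); last first.
  by apply/funext => t /=; rewrite tnth_mktuple.
by apply: measurable_funM => //; exact: measurable_tnth.
Qed.

Lemma measurable_row_of_tuple i :
  measurable_fun [set: Rp] (fun t : Rp => row_of_tuple t 0 i).
Proof.
under eq_fun do rewrite mxE.
exact: measurable_tnth.
Qed.

Lemma measurable_l2norm (d : measure_display) (T : measurableType d)
    (f : T -> 'rV[R]_p) :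
  (forall i, measurable_fun [set: T] (fun t => f t 0 i)) ->
  measurable_fun [set: T] (fun t => l2norm (f t)).
Proof.
move=> mf.
apply: (measurableT_comp (continuous_measurable_fun (@sqrt_continuous R))).
by apply: measurable_sum => i; apply: measurable_funX.
Qed.

End product_form.

Section density.
Context (R : realType) (p : nat) (dZ : measure_display).
Context (Zs : measurableType dZ) (ell : 'rV[R]_p -> Zs -> R).
Context (rho0 rho1 : R) (omega : {ffun 'I_p -> bool} -> R).
Local Notation Rp := (p.-tuple (measurableTypeR R)).
Hypothesis mell : measurable_fun [set: Rp * Zs]
  (fun tz => ell (row_of_tuple tz.1) tz.2).
Hypotheses (rho0_gt0 : 0 < rho0) (rho1_gt0 : 0 < rho1).
Hypothesis omega_ge0 : forall delta, 0 <= omega delta.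
Implicit Types (delta : {ffun 'I_p -> bool}) (z : Zs).

(** The two Gaussian factors of the prior act on complementary coordinates, so
    they merge into one product whose precision depends on the coordinate. *)
Lemma quasi_densityE z delta (theta : 'rV[R]_p) :
  quasi_density ell rho0 rho1 omega z delta theta =
  expR (ell (vmask delta theta) z) * omega delta *
  \prod_i gauss_density (if delta i then rho1 else rho0) 0 (theta 0 i).
Proof.
rewrite /quasi_density !powR_half ?divr_ge0 ?mulr_ge0 ?pi_ge0 ?ltW//.
rewrite -!mulrA; congr (_ * (_ * _)).
rewrite prod_gauss_density// -expRD mulrA -prod_select; congr (_ * expR _).
  by apply: eq_bigr => i _; case: (delta i).
rewrite !sqr_l2norm !mulr_sumr -big_split/=; apply: eq_bigr => i _.
by rewrite !mxE; case: (delta i); rewrite ?mulr0 ?mulr1; ring.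
Qed.

Lemma quasi_density_ge0 z delta (theta : 'rV[R]_p) :
  0 <= quasi_density ell rho0 rho1 omega z delta theta.
Proof.
by rewrite /quasi_density !mulr_ge0 ?expR_ge0 ?powR_ge0.
Qed.

Lemma measurable_ell_mask delta : measurable_fun [set: Rp * Zs]
  (fun tz => ell (vmask delta (row_of_tuple tz.1)) tz.2).
Proof.
under eq_fun do rewrite vmask_row_of_tuple.
have mg : measurable_fun [set: Rp * Zs]
    (fun tz => (tuple_mask delta tz.1, tz.2)).
  apply/measurable_fun_pairP; split; last exact: measurable_snd.
  exact: (measurableT_comp (measurable_tuple_mask delta) measurable_fst).
exact: (measurableT_comp mell mg).
Qed.

Lemma measurable_quasi_density delta : measurable_fun [set: Rp * Zs]
  (fun tz => quasi_density ell rho0 rho1 omega tz.2 delta (row_of_tuple tz.1)).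
Proof.
under eq_fun do rewrite quasi_densityE.
apply: measurable_funM.
  apply: measurable_funM => //; apply: measurableT_comp => //.
  exact: measurable_ell_mask.
apply: measurable_prod => i _; rewrite gauss_densityE; last by case: ifP.
apply: measurableT_comp; first exact: measurable_normal_pdf.
exact: (measurableT_comp (measurable_row_of_tuple i) measurable_fst).
Qed.

Lemma measurable_quasi_density1 z delta : measurable_fun [set: Rp]
  (fun t => quasi_density ell rho0 rho1 omega z delta (row_of_tuple t)).
Proof.
exact: (measurableT_comp (measurable_quasi_density delta)
  (pair2_measurable z)).
Qed.

Lemma measurable_quasi_mass A :
  (forall delta, measurable [set t : Rp | A (delta, row_of_tuple t)]) ->
  measurable_fun [set: Zs] (fun z => quasi_mass ell rho0 rho1 omega z A).
Proof.
move=> mA; apply: emeasurable_sum => delta.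
set S := [set t | _].
pose f (zt : Zs * Rp) : \bar R :=
  ((quasi_density ell rho0 rho1 omega zt.1 delta (row_of_tuple zt.2))%:E *
   (\1_S zt.2)%:E)%E.
rewrite (_ : (fun z => _) = fubini_F (lebesgue_tuple R p) f); last first.
  by apply/funext => z; rewrite integral_mkcond epatch_indic.
apply: measurable_fun_fubini_tonelli_F.
- rewrite /f; under eq_fun do rewrite -EFinM.
  apply/measurable_EFinP; apply: measurable_funM.
    have msw : measurable_fun [set: Zs * Rp] (fun zt => (zt.2, zt.1)).
      apply/measurable_fun_pairP.
      by split; [exact: measurable_snd|exact: measurable_fst].
    exact: (measurableT_comp (measurable_quasi_density delta) msw).
  by apply: (measurableT_comp (measurable_indic _) measurable_snd); exact: mA.
- by move=> zt; rewrite /f -EFinM lee_fin mulr_ge0// quasi_density_ge0.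
Qed.

End density.

(** * Norms of sparse vectors and the prior on models *)

Section norms.
Context (R : realType) (p : nat).
Implicit Types (delta : {ffun 'I_p -> bool}) (theta h : 'rV[R]_p).

Definition l1norm h : R := \sum_i `|h 0 i|.

Lemma l1norm_le_l2norm h (m : nat) : (l0norm h <= m)%N ->
  l1norm h <= Num.sqrt m%:R * l2norm h.
Proof.
move=> hm; set x := l2norm h; set s := Num.sqrt m%:R.
have s2 : s ^+ 2 = m%:R by rewrite sqr_sqrtr.
have [m0|m_gt0] := posnP m.
  have h0 i : h 0 i = 0.
    apply/eqP; apply: contraTT hm => hi; rewrite m0 -ltnNge.
    by apply/card_gt0P; exists i.
  rewrite /l1norm big1 ?mulr_ge0 ?sqrtr_ge0// => i _.
  by rewrite h0 normr0.
have s_gt0 : 0 < s by rewrite sqrtr_gt0 ltr0n.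
have [x0|x_gt0] := eqVneq x 0.
  have : \sum_i h 0 i ^+ 2 = 0 by rewrite -sqr_l2norm -/x x0 expr0n.
  move=> /psumr_eq0P h0; rewrite x0 mulr0 /l1norm big1// => i _.
  have /eqP := h0 (fun i _ => sqr_ge0 _) i isT.
  by rewrite sqrf_eq0 => /eqP ->; rewrite normr0.
have {}x_gt0 : 0 < x by rewrite lt0r x_gt0 l2norm_ge0.
pose c := x / s.
have c_gt0 : 0 < c by rewrite divr_gt0.
(* Arithmetic-geometric mean inequality, balanced by [c]; zero coordinates
   contribute nothing, hence the count [l0norm h] after summation. *)
have amgm i : `|h 0 i| <=
    (if h 0 i != 0 then c / 2 else 0) + h 0 i ^+ 2 / (2 * c).
  have [->|hi] := eqVneq (h 0 i) 0; first by rewrite normr0 expr0n mul0r addr0.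
  rewrite -subr_ge0 -(real_normK (num_real (h 0 i))).
  have -> : c / 2 + `|h 0 i| ^+ 2 / (2 * c) - `|h 0 i| =
      (`|h 0 i| - c) ^+ 2 / (2 * c) by field; rewrite gt_eqF.
  by rewrite divr_ge0 ?sqr_ge0// mulr_ge0// ltW.
rewrite (le_trans (ler_sum _ (fun i _ => amgm i)))// big_split/= -big_mkcond/=.
have -> : \sum_i h 0 i ^+ 2 / (2 * c) = x ^+ 2 / (2 * c).
  by rewrite /x sqr_l2norm mulr_suml.
rewrite sumr_const -[_ *+ #|_|]mulr_natl.
have -> : s * x = m%:R * (c / 2) + x ^+ 2 / (2 * c).
  by rewrite -s2 /c; field; rewrite !gt_eqF.
by rewrite lerD2r ler_wpM2r ?ler_nat// divr_ge0// ltW.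
Qed.

Lemma dotv_le (g h : 'rV[R]_p) : `|dotv g h| <= linfnorm g * l1norm h.
Proof.
rewrite /dotv (le_trans (ler_norm_sum _ _ _))// /l1norm mulr_sumr.
apply: ler_sum => i _; rewrite normrM ler_wpM2r//.
exact: (le_bigmax _ (fun i => `|g 0 i|)).
Qed.

Lemma l0norm_vmaskB delta theta theta' :
  (l0norm (vmask delta theta - theta') <= l0norm theta' + dl0norm delta)%N.
Proof.
rewrite /l0norm /dl0norm -cardUI (leq_trans _ (leq_addr _ _))//.
apply: subset_leq_card; apply/fintype.subsetP => i.
rewrite !inE !mxE; apply: contraR.
rewrite negb_or negbK => /andP[/eqP-> /negbTE->].
by rewrite mulr0 subr0.
Qed.

Lemma l0norm_le theta : (l0norm theta <= p)%N.
Proof. by rewrite (leq_trans (max_card _))// card_ord. Qed.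

Lemma dl0norm_vsupport theta : dl0norm (vsupport theta) = l0norm theta.
Proof. by apply: eq_card => i; rewrite !inE ffunE. Qed.

(** Expand the product over coordinates of [q + (1 - q)]. *)
Lemma sum_bernoulli_prior (q : R) :
  \sum_(delta : {ffun 'I_p -> bool}) bernoulli_prior q delta = 1.
Proof.
transitivity (\prod_(i < p) \sum_(b : bool) (if b then q else 1 - q)).
  rewrite bigA_distr_bigA; apply: eq_bigr => delta _.
  by rewrite prod_select.
by rewrite big1// => i _; rewrite big_bool/= addrC subrK.
Qed.

End norms.

Section constants.
Context (R : realType).

Lemma expR1_le8 : expR 1 <= 8 :> R.
Proof.
have h : 2^-1 <= expR (- 2^-1) :> R.
  by apply: le_trans (expR_ge1Dx _); lra.
have e : expR 1 * (expR (- 2^-1) * expR (- 2^-1)) = 1 :> R.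
  by rewrite -!expRD -[RHS]expR0; congr expR; lra.
have : expR 1 * (2^-1 * 2^-1) <= 1 :> R.
  by rewrite -[leRHS]e ler_wpM2l ?expR_ge0// ler_pM.
lra.
Qed.

Lemma sqrt2_le_expR1 : Num.sqrt 2 <= expR 1 :> R.
Proof.
apply: le_trans (expR_ge1Dx 1).
by rewrite -[leRHS](@ger0_norm _ _) ?ler_sqrt// -sqrtr_sqr ler_sqrt//; lra.
Qed.

(** In terms of the odds [tau = p^-(1 + u)] the weight is
    [tau^s * (1 + tau)^-p], and [(1 + tau)^p <= exp (p * tau) <= exp 1]. *)
Lemma bernoulli_prior_ge (p s : nat) (q u : R) : (s <= p)%N -> (0 < p)%N ->
  0 < u -> 0 < q < 1 -> q / (1 - q) = 1 / (p%:R `^ (u + 1)) ->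
  expR (- 1 - (1 + u) * s%:R * ln p%:R) <= q ^+ s * (1 - q) ^+ (p - s).
Proof.
move=> sp p0 u0 /andP[q0 q1] qE.
have pR : 1 <= p%:R :> R by rewrite ler1n.
have pR0 : 0 < p%:R :> R by rewrite ltr0n.
have q1' : 0 < 1 - q by rewrite subr_gt0.
set tau := q / (1 - q) in qE.
have tauE : tau = expR (- ((u + 1) * ln p%:R)).
  by rewrite qE div1r /powR gt_eqF// expRN.
have tau_le : tau * p%:R <= 1.
  have -> : p%:R = expR (ln p%:R) :> R by rewrite lnK// posrE.
  rewrite lnK ?posrE// tauE -{2}(lnK pR0) -expRD expR_le1.
  have := ln_ge0 pR; nra.
have -> : q ^+ s * (1 - q) ^+ (p - s) = tau ^+ s * (1 - q) ^+ p.
  rewrite -{2}(subnKC sp) exprD mulrA -exprMn /tau divfK//.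
  by rewrite gt_eqF.
have q1E : expR (- tau) <= 1 - q.
  have q1tau : 1 - q = (1 + tau)^-1.
    apply: invr_inj; rewrite invrK /tau.
    by field; rewrite gt_eqF.
  have tau0 : 0 < tau by rewrite divr_gt0.
  by rewrite q1tau expRN lef_pV2 ?posrE ?expR_gt0 ?expR_ge1Dx// addr_gt0.
rewrite -[_ - _]addrC expRD ler_pM ?expR_ge0//.
  by rewrite tauE -expRM_natl ler_expR; lra.
apply: (@le_trans _ _ (expR (- tau) ^+ p)); last first.
  by rewrite lerXn2r ?nnegrE ?expR_ge0// ltW.
by rewrite -expRM_natl ler_expR; lra.
Qed.

End constants.

(** * Pointwise bounds on the quasi-density *)

Section density_bounds.
Context (R : realType) (p : nat) (dZ : measure_display).
Context (Zs : measurableType dZ) (ell : 'rV[R]_p -> Zs -> R).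
Context (rho0 rho1 : R) (omega : {ffun 'I_p -> bool} -> R).
Local Notation Rp := (p.-tuple (measurableTypeR R)).
Hypothesis mell : measurable_fun [set: Rp * Zs]
  (fun tz => ell (row_of_tuple tz.1) tz.2).
Hypotheses (rho0_gt0 : 0 < rho0) (rho1_gt0 : 0 < rho1).
Hypothesis omega_ge0 : forall delta, 0 <= omega delta.
Implicit Types (delta : {ffun 'I_p -> bool}) (z : Zs).
Implicit Types theta thetas : 'rV[R]_p.
Local Notation dens := (quasi_density ell rho0 rho1 omega).

(** With [h := theta_delta - thetas], expanding the squares leaves
    [- rho1 * <thetas, h>] on the coordinates in [delta]; on the others
    [h = - thetas], and the discrepancy [rho1 / 2 * thetas_i^2] has the
    right sign. *)
Lemma prod_gauss_recenter delta thetas theta :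
  \prod_i gauss_density (if delta i then rho1 else rho0) 0 (theta 0 i) <=
  expR (rho1 * linfnorm thetas * l1norm (vmask delta theta - thetas)
        - rho1 / 2 * l2norm thetas ^+ 2) *
  \prod_i gauss_density (if delta i then rho1 else rho0)
                        (if delta i then thetas 0 i else 0) (theta 0 i).
Proof.
rewrite !prod_gauss_density mulrCA ler_wpM2l//.
  by apply: prodr_ge0 => i _; exact: sqrtr_ge0.
rewrite -expRD ler_expR; set h := vmask delta theta - thetas.
have : - dotv thetas h <= linfnorm thetas * l1norm h.
  by rewrite (le_trans _ (dotv_le _ _))// -normrN ler_norm.
rewrite -(ler_pM2l rho1_gt0) mulrA => dot_le.
rewrite -subr_ge0.
apply: le_trans (_ : 0 <= rho1 * - dotv thetas h -
    rho1 / 2 * l2norm thetas ^+ 2 + _ - _) _; last first.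
  by apply: lerB => //; apply: lerD => //; exact: lerB.
rewrite /dotv sqr_l2norm -sumrN !mulr_sumr -!sumrB -!big_split/=.
rewrite -sumrB; apply: sumr_ge0 => i _; rewrite !mxE.
case: (delta i) => /=; rewrite ?mulr1 ?mulr0.
  by rewrite le_eqVlt; apply/orP; left; apply/eqP; field.
have -> : rho1 * - (thetas 0 i * (0 - thetas 0 i)) - rho1 / 2 * thetas 0 i ^+ 2
  + - (rho0 / 2) * (theta 0 i - 0) ^+ 2 - - (rho0 / 2) * (theta 0 i - 0) ^+ 2
  = rho1 / 2 * thetas 0 i ^+ 2 by field.
by rewrite mulr_ge0 ?sqr_ge0// divr_ge0// ltW.
Qed.

(** The exponent is [- r x / 2] from the Bregman term, plus
    [rhob / 2 * |h|_1] from the gradient, plus [rhob / 32 * |h|_1] from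
    recentring the slab; with [|h|_1 <= sqrt m * x] and
    [r x >= 2 * sqrt m * rhob * x] this is at most
    [(- 1 + 17 / 32) * rhob * sqrt m * x]. *)
Lemma quasi_density_far z delta thetas theta (rhob rx : R) (m : nat) :
  let h := vmask delta theta - thetas in
  let x := l2norm h in
  0 < rhob ->
  (l0norm thetas + dl0norm delta <= m)%N ->
  linfnorm (grad (ell^~ z) thetas) <= rhob / 2 ->
  32 * rho1 * linfnorm thetas <= rhob ->
  bregman ell thetas (vmask delta theta) z <= - (1 / 2) * rx ->
  2 * Num.sqrt m%:R * rhob * x <= rx ->
  dens z delta theta <=
    omega delta * expR (ell thetas z - rho1 / 2 * l2norm thetas ^+ 2
                        - 15 / 32 * (rhob * Num.sqrt m%:R * x)) *
  \prod_i gauss_density (if delta i then rho1 else rho0)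
                        (if delta i then thetas 0 i else 0) (theta 0 i).
Proof.
move=> h x rhob0 hm hg hth hb hr.
have h1 : l1norm h <= Num.sqrt m%:R * x.
  by apply: l1norm_le_l2norm; rewrite (leq_trans (l0norm_vmaskB _ _ _)).
have h10 : 0 <= l1norm h by apply: sumr_ge0.
rewrite quasi_densityE// [_ * omega _]mulrC -!mulrA ler_wpM2l//.
apply: (le_trans (ler_wpM2l (expR_ge0 _) (prod_gauss_recenter _ thetas _))).
rewrite [leLHS]mulrA -expRD ler_wpM2r//.
  apply: prodr_ge0 => i _.
  by rewrite mulr_ge0 ?sqrtr_ge0 ?expR_ge0.
rewrite ler_expR -/h.
have hdot : dotv (grad (ell^~ z) thetas) h <= rhob / 2 * l1norm h.
  apply: le_trans (ler_norm _) _; apply: le_trans (dotv_le _ _) _.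
  by rewrite ler_wpM2r.
move: hb; rewrite /bregman -/h => hb.
have hth' : rho1 * linfnorm thetas * l1norm h <= rhob / 32 * l1norm h.
  by rewrite ler_wpM2r//; lra.
have h2 : 17 / 32 * rhob * l1norm h <= 17 / 32 * rhob * (Num.sqrt m%:R * x).
  by rewrite ler_wpM2l// mulr_ge0 ?ltW//; lra.
lra.
Qed.

Lemma integral_prod_gauss (rho m : 'I_p -> R) : (forall i, 0 < rho i) ->
  (\int[lebesgue_tuple R p]_t
    (\prod_i gauss_density (rho i) (m i) (row_of_tuple t 0 i))%:E = 1)%E.
Proof.
move=> rho_gt0; under eq_integral do under eq_bigr do rewrite mxE.
apply: (@integral_prod_density R p (fun i => gauss_density (rho i) (m i))).
by move=> i; exact: prob_density_gauss.
Qed.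

Lemma measurable_prod_gauss (rho m : 'I_p -> R) : (forall i, 0 < rho i) ->
  measurable_fun [set: Rp]
    (fun t => \prod_i gauss_density (rho i) (m i) (row_of_tuple t 0 i)).
Proof.
move=> rho_gt0; apply: measurable_prod => i _.
apply: (measurableT_comp _ (measurable_row_of_tuple i)).
by case: (prob_density_gauss (m i) (rho_gt0 i)).
Qed.

(** Coordinatewise, linear term of the likelihood, curvature and slab form a
    quadratic with leading coefficient [- c / 2]; completing the square gives a
    Gaussian of precision [c] with a shifted mean, and the nonnegative constant
    left over is dropped. *)
Lemma quasi_density_lower z thetas theta (kappa : R) : 0 < kappa ->
  let ds := vsupport thetas in
  let c := kappa + rho1 in
  (forall theta', vmask_space ds theta' ->
    - (kappa / 2) * l2norm (theta' - thetas) ^+ 2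
      <= bregman ell thetas theta' z) ->
  omega ds * expR (ell thetas z - rho1 / 2 * l2norm thetas ^+ 2) *
    Num.sqrt (rho1 / c) ^+ l0norm thetas *
  \prod_i gauss_density (if ds i then c else rho0)
    (if ds i
     then thetas 0 i + (grad (ell^~ z) thetas 0 i - rho1 * thetas 0 i) / c
     else 0) (theta 0 i)
  <= dens z ds theta.
Proof.
move=> kappa0 ds c hb.
have c0 : 0 < c by rewrite addr_gt0.
set G := grad _ _.
rewrite quasi_densityE// [_ * omega _]mulrC -!mulrA ler_wpM2l//.
set h := vmask ds theta - thetas.
have hell : ell thetas z + dotv G h - kappa / 2 * l2norm h ^+ 2
    <= ell (vmask ds theta) z.
  have : vmask_space ds (vmask ds theta) by exists theta.
  by move=> /hb; rewrite /bregman -/G -/h; lra.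
apply: le_trans (_ :
  expR (ell thetas z + dotv G h - kappa / 2 * l2norm h ^+ 2) * _ <= _);
  last first.
  apply: ler_wpM2r; last by rewrite ler_expR; exact: hell.
  apply: prodr_ge0 => i _.
  by rewrite mulr_ge0 ?sqrtr_ge0 ?expR_ge0.
rewrite -addrA !expRD -!mulrA ler_wpM2l ?expR_ge0//.
have -> : Num.sqrt (rho1 / c) ^+ l0norm thetas =
    \prod_i (if ds i then Num.sqrt (rho1 / c) else 1).
  by rewrite prod_select expr1n mulr1 dl0norm_vsupport.
rewrite [leRHS]mulrA -expRD.
have -> : - (rho1 * (2^-1 * l2norm thetas ^+ 2)) =
    \sum_i - (rho1 / 2 * thetas 0 i ^+ 2).
  by rewrite mulrA sqr_l2norm mulr_sumr sumrN.
have -> : dotv G h - kappa * (2^-1 * l2norm h ^+ 2) =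
    \sum_i (G 0 i * h 0 i - kappa / 2 * h 0 i ^+ 2).
  by rewrite mulrA sqr_l2norm mulr_sumr /dotv -sumrB.
rewrite !expR_sum -!big_split/=; apply: ler_prod => i _.
apply/andP; split.
  rewrite !mulr_ge0 ?expR_ge0 ?sqrtr_ge0//; by case: ifP.
have -> : h 0 i = theta 0 i * (ds i)%:R - thetas 0 i by rewrite !mxE.
move: (G 0 i) => g; rewrite /ds !ffunE.
have [->|ti] /= := eqVneq (thetas 0 i) 0.
  by rewrite expr0n !mulr0 !subr0 !mulr0 expr0n !mulr0 oppr0 addr0 mul1r.
rewrite mulr1 /gauss_density.
set m := thetas 0 i + _.
have -> : Num.sqrt (rho1 / (2 * pi)) =
    Num.sqrt (rho1 / c) * Num.sqrt (c / (2 * pi)).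
  rewrite -sqrtrM; last by rewrite divr_ge0 ?ltW.
  congr Num.sqrt; rewrite mulrA divfK//.
  by rewrite gt_eqF.
rewrite !mulrA -![expR _ * _ * _]mulrA ![expR _ * (_ * _)]mulrC -!mulrA.
rewrite !ler_wpM2l ?sqrtr_ge0// -!expRD ler_expR.
rewrite -subr_ge0; set D := (X in 0 <= X).
have -> : D = (g - rho1 * thetas 0 i) ^+ 2 / (2 * c).
  by rewrite /D /m /c; field; rewrite gt_eqF.
by rewrite divr_ge0 ?sqr_ge0// mulr_ge0// ltW.
Qed.

End density_bounds.

(** * Bounds on the mass of a model *)

Section mass_bounds.
Context (R : realType) (p : nat) (dZ : measure_display).
Context (Zs : measurableType dZ) (ell : 'rV[R]_p -> Zs -> R).
Context (rho0 rho1 : R) (omega : {ffun 'I_p -> bool} -> R).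
Local Notation Rp := (p.-tuple (measurableTypeR R)).
Hypothesis mell : measurable_fun [set: Rp * Zs]
  (fun tz => ell (row_of_tuple tz.1) tz.2).
Hypotheses (rho0_gt0 : 0 < rho0) (rho1_gt0 : 0 < rho1).
Hypothesis omega_ge0 : forall delta, 0 <= omega delta.
Implicit Types (delta : {ffun 'I_p -> bool}) (z : Zs).
Implicit Types theta thetas : 'rV[R]_p.
Local Notation dens := (quasi_density ell rho0 rho1 omega).

(** The tilt halves the precision; [sqrt 2] is the ratio of the normalizing
    constants. *)
Lemma gauss_density_tilt (rho x : R) : 0 < rho ->
  gauss_density rho 0 x * expR (rho / 4 * x ^+ 2) =
  Num.sqrt 2 * gauss_density (rho / 2) 0 x.
Proof.
move=> rho_gt0; rewrite /gauss_density subr0 -[LHS]mulrA -expRD.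
rewrite [RHS]mulrA -sqrtrM//; congr (Num.sqrt _ * expR _); last by field.
have := pi_gt0 R; move: (pi : R) => P P0.
by field; rewrite gt_eqF.
Qed.

Lemma measurable_outer_l2norm delta : measurable_fun [set: Rp]
  (fun t => l2norm (row_of_tuple t - vmask delta (row_of_tuple t))).
Proof.
apply: measurable_l2norm => i.
rewrite (_ : (fun t => _) =
    fun t : Rp => tnth t i - tnth t i * (delta i)%:R); last first.
  by apply/funext => t; rewrite !mxE.
apply: measurable_funB; first exact: measurable_tnth.
by apply: measurable_funM => //; exact: measurable_tnth.
Qed.

(** The likelihood only sees the coordinates in [delta], so the tilt acts on the
    remaining coordinates as on independent Gaussians. *)
Lemma integral_density_tilt z delta :
  (\int[lebesgue_tuple R p]_t
     (dens z delta (row_of_tuple t) * expR (rho0 / 4 *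
       l2norm (row_of_tuple t - vmask delta (row_of_tuple t)) ^+ 2))%:E =
   (Num.sqrt 2 ^+ (p - dl0norm delta))%:E *
   \int[lebesgue_tuple R p]_t (dens z delta (row_of_tuple t))%:E)%E.
Proof.
pose F (t : Rp) := expR (ell (vmask delta (row_of_tuple t)) z) * omega delta *
  \prod_(i < p | delta i) gauss_density rho1 0 (tnth t i).
have densF (t : Rp) : dens z delta (row_of_tuple t) =
    F t * \prod_(i < p | ~~ delta i) gauss_density rho0 0 (tnth t i).
  rewrite quasi_densityE// /F -[RHS]mulrA; congr (_ * _).
  rewrite (bigID [pred i | delta i])/=; congr (_ * _).
    by apply: eq_bigr => i ->; rewrite mxE.
  by apply: eq_bigr => i /negbTE->; rewrite mxE.
have outer (t : Rp) :
    l2norm (row_of_tuple t - vmask delta (row_of_tuple t)) ^+ 2 =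
    \sum_(i < p | ~~ delta i) tnth t i ^+ 2.
  rewrite sqr_l2norm [RHS]big_mkcond; apply: eq_bigr => i _; rewrite !mxE.
  by case: (delta i); rewrite /= ?mulr1 ?mulr0 ?subrr ?subr0// expr0n.
have tilt (t : Rp) : dens z delta (row_of_tuple t) * expR (rho0 / 4 *
      l2norm (row_of_tuple t - vmask delta (row_of_tuple t)) ^+ 2) =
    Num.sqrt 2 ^+ (p - dl0norm delta) *
    (F t * \prod_(i < p | ~~ delta i) gauss_density (rho0 / 2) 0 (tnth t i)).
  rewrite densF outer mulr_sumr expR_sum -mulrA -big_split/= mulrCA.
  congr (_ * _); rewrite dl0normC -prodr_const -big_split/=.
  by apply: eq_bigr => i _; rewrite gauss_density_tilt.
have F0 t : 0 <= F t.
  rewrite /F !mulr_ge0 ?expR_ge0// prodr_ge0// => i _.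
  by rewrite mulr_ge0 ?sqrtr_ge0 ?expR_ge0.
have mF : measurable_fun [set: Rp] F.
  apply: measurable_funM.
    apply: measurable_funM => //; apply: measurableT_comp => //.
    exact: (measurableT_comp (measurable_ell_mask mell delta)
      (pair2_measurable z)).
  under eq_fun do rewrite big_mkcond.
  apply: (@measurable_prod_coord _ _
    (fun i x => if delta i then gauss_density rho1 0 x else 1)) => i.
  case: (delta i) => //; exact: measurable_density (prob_density_gauss _ _).
have half_gt0 : 0 < rho0 / 2 by rewrite divr_gt0.
pose H (t : Rp) :=
  F t * \prod_(i < p | ~~ delta i) gauss_density (rho0 / 2) 0 (tnth t i).
have mH : measurable_fun [set: Rp] (EFin \o H).
  apply/measurable_EFinP; apply: measurable_funM => //.
  under eq_fun do rewrite big_mkcond.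
  apply: (@measurable_prod_coord _ _
    (fun i x => if ~~ delta i then gauss_density (rho0 / 2) 0 x else 1)) => i.
  case: (~~ delta i) => //; exact: measurable_density (prob_density_gauss _ _).
have H0 (t : Rp) : [set: Rp] t -> (0 <= (EFin \o H) t)%E.
  move=> _; rewrite lee_fin mulr_ge0// prodr_ge0// => i _.
  by rewrite mulr_ge0 ?sqrtr_ge0 ?expR_ge0.
have sqrt2_ge0 : (0 <= (Num.sqrt 2 ^+ (p - dl0norm delta))%:E :> \bar R)%E.
  by rewrite lee_fin exprn_ge0// sqrtr_ge0.
transitivity (\int[lebesgue_tuple R p]_t
    ((Num.sqrt 2 ^+ (p - dl0norm delta))%:E * (EFin \o H) t))%E.
  by apply: eq_integral => t _; rewrite tilt EFinM.
rewrite (ge0_integralZl (lebesgue_tuple R p) measurableT mH H0 sqrt2_ge0).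
apply: (congr1 (fun x => _ * x)%E).
transitivity (\int[lebesgue_tuple R p]_t
  (F t * \prod_(i < p | ~~ delta i) gauss_density rho0 0 (tnth t i))%:E)%E;
  last by apply: eq_integral => t _; rewrite densF.
apply: (@integral_swap_density R p (fun i => delta i) F
  (fun=> gauss_density (rho0 / 2) 0) (fun=> gauss_density rho0 0)) => //.
- move=> t t' tt'; rewrite /F; congr (_ * _).
    congr (expR (ell _ z) * _); apply/rowP => i; rewrite !mxE.
    by case: (boolP (delta i)) => [/tt' ->//|_]; rewrite !mulr0.
  by apply: eq_bigr => i /tt' ->.
- by move=> i; exact: prob_density_gauss.
- by move=> i; exact: prob_density_gauss.
Qed.

(** The points of [S] are of two kinds: those where the quasi-density is below
    [N] times a probability density, and those with a long inactive part, where
    the indicator is below the Chernoff weight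
    [exp (rho0 / 4 * |x|^2 - (1 + C1) * p / 4)].  Bounding [sqrt 2] by
    [exp 1] makes [(1 + C1) / 4 >= 2] sufficient. *)
Lemma quasi_slice_le z delta (S : set Rp) (N C1 : R) (m : 'I_p -> R) :
  7 <= C1 -> measurable S -> 0 <= N ->
  (forall t, S t ->
    dens z delta (row_of_tuple t) <=
      N * \prod_i gauss_density (if delta i then rho1 else rho0) (m i)
                                (row_of_tuple t 0 i) \/
    Num.sqrt ((1 + C1) * rho0^-1 * p%:R) <
      l2norm (row_of_tuple t - vmask delta (row_of_tuple t))) ->
  (\int[lebesgue_tuple R p]_(t in S) (dens z delta (row_of_tuple t))%:E <=
   N%:E + (expR (- p%:R))%:E *
     \int[lebesgue_tuple R p]_t (dens z delta (row_of_tuple t))%:E)%E.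
Proof.
move=> C17 mS N0 hS.
pose b := (1 + C1) * p%:R / 4.
pose G (t : Rp) := \prod_i gauss_density (if delta i then rho1 else rho0) (m i)
                                (row_of_tuple t 0 i).
pose T (t : Rp) := dens z delta (row_of_tuple t) * expR (rho0 / 4 *
       l2norm (row_of_tuple t - vmask delta (row_of_tuple t)) ^+ 2).
have d0 t : 0 <= dens z delta (row_of_tuple t) by exact: quasi_density_ge0.
have md : measurable_fun [set: Rp] (fun t => dens z delta (row_of_tuple t)).
  exact: measurable_quasi_density1.
have G0 t : 0 <= G t.
  by apply: prodr_ge0 => i _; rewrite mulr_ge0 ?sqrtr_ge0 ?expR_ge0.
have T0 t : 0 <= T t by rewrite mulr_ge0 ?expR_ge0.
have mG : measurable_fun [set: Rp] G.
  by apply: measurable_prod_gauss => i; case: ifP.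
have mT : measurable_fun [set: Rp] T.
  apply: measurable_funM => //; apply: measurableT_comp => //.
  apply: measurable_funM => //; apply: measurable_funX.
  exact: measurable_outer_l2norm.
have le t : S t -> dens z delta (row_of_tuple t) <= N * G t + expR (- b) * T t.
  move=> /hS[le1|lt2].
    by apply: (le_trans le1); rewrite lerDl mulr_ge0 ?expR_ge0.
  apply: (@le_trans _ _ (expR (- b) * T t)); last first.
    by rewrite lerDr mulr_ge0.
  rewrite /T mulrCA -expRD ler_peMr// -[leLHS]expR0 ler_expR addrC subr_ge0 /b.
  have r0 : 0 <= (1 + C1) * rho0^-1 * p%:R.
    by rewrite !mulr_ge0 ?invr_ge0// ?(ltW rho0_gt0)//; lra.
  have : (1 + C1) * rho0^-1 * p%:R <=
      l2norm (row_of_tuple t - vmask delta (row_of_tuple t)) ^+ 2.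
    rewrite -[leLHS]sqr_sqrtr// lerXn2r ?nnegrE ?sqrtr_ge0//; exact: ltW.
  have q0 : 0 <= rho0 / 4 by rewrite divr_ge0// ltW.
  move=> /(ler_wpM2l q0); apply: le_trans.
  by rewrite le_eqVlt; apply/orP; left; apply/eqP; field; rewrite gt_eqF.
apply: (@le_trans _ _
  (\int[lebesgue_tuple R p]_t (N * G t + expR (- b) * T t)%:E)%E).
  apply: (@le_trans _ _
    (\int[lebesgue_tuple R p]_(t in S) (N * G t + expR (- b) * T t)%:E)%E).
    apply: ge0_le_integral => //.
    - by move=> t _; rewrite lee_fin.
    - by apply/measurable_EFinP; apply: measurable_funS md.
    - apply/measurable_EFinP; apply: (@measurable_funS _ _ _ _ setT) => //.
      by apply: measurable_funD; apply: measurable_funM.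
  apply: ge0_subset_integral => //.
  - by apply/measurable_EFinP; apply: measurable_funD; apply: measurable_funM.
  - by move=> t _; rewrite lee_fin addr_ge0// mulr_ge0 ?expR_ge0.
have mGE : measurable_fun [set: Rp] (EFin \o G) by exact/measurable_EFinP.
have mTE : measurable_fun [set: Rp] (EFin \o T) by exact/measurable_EFinP.
have GE0 (t : Rp) : [set: Rp] t -> (0 <= (EFin \o G) t)%E by rewrite lee_fin.
have TE0 (t : Rp) : [set: Rp] t -> (0 <= (EFin \o T) t)%E by rewrite lee_fin.
have eb0 : (0 <= (expR (- b))%:E)%E by rewrite lee_fin expR_ge0.
rewrite [leLHS](_ : _ = (N%:E * (\int[lebesgue_tuple R p]_t (G t)%:E) +
    (expR (- b))%:E * (\int[lebesgue_tuple R p]_t (T t)%:E))%E); last first.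
  rewrite -(ge0_integralZl _ measurableT mGE GE0)//.
  rewrite -(ge0_integralZl _ measurableT mTE TE0 eb0).
  rewrite -ge0_integralD//.
  - by move=> t tT; rewrite mule_ge0// GE0.
  - exact: measurable_funeM.
  - by move=> t tT; rewrite mule_ge0// TE0.
  - exact: measurable_funeM.
have -> : (\int[lebesgue_tuple R p]_t (G t)%:E = 1)%E.
  by apply: integral_prod_gauss => i; case: ifP.
rewrite mule1 leeD2l// integral_density_tilt muleA -EFinM.
apply: lee_wpmul2r; first by apply: integral_ge0 => t _; rewrite lee_fin.
rewrite lee_fin.
apply: (@le_trans _ _ (expR (- b) * expR 1 ^+ p)).
  apply: ler_wpM2l; first exact: expR_ge0.
  apply: (@le_trans _ _ (expR 1 ^+ (p - dl0norm delta))).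
    by rewrite lerXn2r ?nnegrE ?sqrtr_ge0 ?expR_ge0// sqrt2_le_expR1.
  by rewrite ler_weXn2l ?leq_subr// -[leLHS]expR0 ler_expR.
rewrite -expRM_natl mulr1 -expRD ler_expR /b.
have : 0 <= p%:R :> R by [].
by move: C17; nra.
Qed.

Lemma quasi_mass_setT z : quasi_mass ell rho0 rho1 omega z setT =
  (\sum_(delta : {ffun 'I_p -> bool})
    \int[lebesgue_tuple R p]_t (dens z delta (row_of_tuple t))%:E)%E.
Proof. by []. Qed.

(** Only the mass of the model supporting [thetas] is kept. *)
Lemma quasi_mass_ge z thetas (kappa : R) : 0 < kappa ->
  (forall theta, vmask_space (vsupport thetas) theta ->
    - (kappa / 2) * l2norm (theta - thetas) ^+ 2
      <= bregman ell thetas theta z) ->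
  ((omega (vsupport thetas) *
    expR (ell thetas z - rho1 / 2 * l2norm thetas ^+ 2) *
    Num.sqrt (rho1 / (kappa + rho1)) ^+ l0norm thetas)%:E <=
   quasi_mass ell rho0 rho1 omega z setT)%E.
Proof.
move=> kappa0 hb; set L := _ * _.
have L0 : 0 <= L by rewrite !mulr_ge0 ?expR_ge0 ?exprn_ge0 ?sqrtr_ge0.
have d0 delta t : 0 <= dens z delta (row_of_tuple t).
  exact: quasi_density_ge0.
set ds := vsupport thetas.
rewrite quasi_mass_setT (bigD1 ds)//=.
apply: (@le_trans _ _
  (\int[lebesgue_tuple R p]_t (dens z ds (row_of_tuple t))%:E)%E); last first.
  rewrite leeDl// sume_ge0// => delta _.
  by apply: integral_ge0 => t _; rewrite lee_fin.
pose c := kappa + rho1.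
pose m i := if ds i then
    thetas 0 i + (grad (ell^~ z) thetas 0 i - rho1 * thetas 0 i) / c else 0.
have c0 : 0 < c by rewrite addr_gt0.
pose G (t : Rp) :=
  \prod_i gauss_density (if ds i then c else rho0) (m i) (row_of_tuple t 0 i).
have G0 t : 0 <= G t.
  by apply: prodr_ge0 => i _; rewrite mulr_ge0 ?sqrtr_ge0 ?expR_ge0.
have mG : measurable_fun [set: Rp] G.
  by apply: measurable_prod_gauss => i; case: ifP.
apply: (@le_trans _ _ (\int[lebesgue_tuple R p]_t (L * G t)%:E)%E).
  under eq_integral do rewrite EFinM.
  rewrite ge0_integralZl ?lee_fin//; last 2 first.
  - exact/measurable_EFinP.
  - by move=> t _; rewrite lee_fin.
  rewrite integral_prod_gauss ?mule1// => i.
  by case: ifP.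
apply: ge0_le_integral => //.
- by move=> t _; rewrite lee_fin mulr_ge0.
- by apply/measurable_EFinP; apply: measurable_funM.
- by apply/measurable_EFinP; exact: measurable_quasi_density1.
- by move=> t _; rewrite lee_fin; exact: quasi_density_lower.
Qed.

End mass_bounds.

(** * The contraction radius and the weight of the true model *)

Section radius.
Context (R : realType).

Lemma contraction_radius_ge0 (r : R -> R) (rhob : R) (s sb : nat) :
  (0 <= contraction_radius r rhob s sb)%E.
Proof. by apply/ereal_infP => _ [y [y0 _] <-]; rewrite lee_fin ltW. Qed.

Lemma rate_above_radius (r : R -> R) (rhob x : R) (s sb : nat) :
  (contraction_radius r rhob s sb < x%:E)%E ->
  2 * Num.sqrt (s + sb)%:R * rhob * x <= r x.
Proof.
move=> /ereal_inf_lt[_ [y [_ hy] <-]]; rewrite lte_fin => /ltW /hy.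
by rewrite subr_ge0.
Qed.

(** Writing [A'] for the left-hand side of the last hypothesis, the parenthesis
    on the right is at least [exp (- 1 - A' / 32)], and [A' <= A]; the constant
    [8] pays for [exp 1]. *)
Lemma far_weight_le (p s : nat) (q u kappa rho1 A : R) :
  (s <= p)%N -> (0 < p)%N -> 0 < u -> 0 < kappa -> 0 < rho1 -> 0 < q < 1 ->
  q / (1 - q) = 1 / (p%:R `^ (u + 1)) ->
  32 * ((1 + u) * s%:R * ln (p%:R + p%:R * kappa / rho1)) <= A ->
  expR (- (15 / 32 * A)) <= 8 * expR (- (A / 32)) *
    (q ^+ s * (1 - q) ^+ (p - s) * Num.sqrt (rho1 / (kappa + rho1)) ^+ s).
Proof.
move=> sp p0 u0 k0 r0 q01 qE hA.
have pR0 : 0 < p%:R :> R by rewrite ltr0n.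
have x0 : 0 < kappa / rho1 by rewrite divr_gt0.
have y0 : 0 < 1 + kappa / rho1 by rewrite addr_gt0.
set l := ln (1 + kappa / rho1).
have l0 : 0 <= l by rewrite ln_ge0// lerDl ltW.
have lp0 : 0 <= ln p%:R :> R by rewrite ln_ge0// ler1n.
have lnE : ln (p%:R + p%:R * kappa / rho1) = ln p%:R + l.
  by rewrite -lnM ?posrE// mulrDr mulr1 mulrA.
rewrite lnE in hA.
have -> : Num.sqrt (rho1 / (kappa + rho1)) = expR (- (l / 2)).
  have -> : rho1 / (kappa + rho1) = expR (- l).
    by rewrite expRN lnK ?posrE//; field; rewrite !gt_eqF ?addr_gt0.
  have -> : expR (- l) = expR (- (l / 2)) ^+ 2.
    by rewrite -expRM_natl; congr expR; lra.
  by rewrite sqrtr_sqr ger0_norm// expR_ge0.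
rewrite -expRM_natl.
apply: (@le_trans _ _ (8 * expR (- (A / 32)) *
  (expR (- 1 - (1 + u) * s%:R * ln p%:R) * expR (s%:R * - (l / 2)))));
  last first.
  rewrite ler_wpM2l ?mulr_ge0 ?expR_ge0// ler_wpM2r ?expR_ge0//.
  exact: bernoulli_prior_ge.
apply: (@le_trans _ _ (expR 1 * (expR (- (A / 32)) *
  (expR (- 1 - (1 + u) * s%:R * ln p%:R) * expR (s%:R * - (l / 2))))));
  last by rewrite -[leRHS]mulrA ler_wpM2r ?mulr_ge0 ?expR_ge0// expR1_le8.
rewrite -!expRD ler_expR.
have s0 : 0 <= s%:R :> R by [].
have : 0 <= u * (s%:R * l) by rewrite !mulr_ge0// ltW.
have : 0 <= s%:R * l by rewrite mulr_ge0.
have : 0 <= (1 + u) * s%:R * ln p%:R by rewrite !mulr_ge0// addr_ge0// ltW.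
nra.
Qed.

End radius.

(** * Contraction for a fixed observation *)

Section posterior_contraction.
Context (R : realType) (p : nat) (dZ : measure_display).
Context (Zs : measurableType dZ) (ell : 'rV[R]_p -> Zs -> R).
Context (rho0 rho1 q : R).
Local Notation Rp := (p.-tuple (measurableTypeR R)).
Hypothesis mell : measurable_fun [set: Rp * Zs]
  (fun tz => ell (row_of_tuple tz.1) tz.2).
Hypotheses (rho0_gt0 : 0 < rho0) (rho1_gt0 : 0 < rho1) (q01 : 0 < q < 1).
Implicit Types (delta : {ffun 'I_p -> bool}) (z : Zs).
Implicit Types theta thetas : 'rV[R]_p.
Local Notation omega := (bernoulli_prior (p := p) q).
Local Notation dens := (quasi_density ell rho0 rho1 omega).
Local Notation mass := (quasi_mass ell rho0 rho1 omega).
Local Notation slice A delta := [set t : Rp | A (delta, row_of_tuple t)].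

Lemma bernoulli_prior_ge0 delta : 0 <= omega delta.
Proof.
case/andP: q01 => q0 q1.
by rewrite mulr_ge0// exprn_ge0// ?subr_ge0 ltW.
Qed.

Let omega_ge0 := bernoulli_prior_ge0.

Let dens_ge0 z delta theta : 0 <= dens z delta theta.
Proof. exact: quasi_density_ge0. Qed.

Let mdens z delta : measurable_fun [set: Rp]
  (fun t => (dens z delta (row_of_tuple t))%:E).
Proof. by apply/measurable_EFinP; exact: measurable_quasi_density1. Qed.

Lemma quasi_mass_ge0 z A : (0 <= mass z A)%E.
Proof.
by apply: sume_ge0 => delta _; apply: integral_ge0 => t _; rewrite lee_fin.
Qed.

Lemma le_quasi_mass_setT z A : (forall delta, measurable (slice A delta)) ->
  (mass z A <= mass z setT)%E.
Proof.
move=> mA; apply: lee_sum => delta _.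
apply: ge0_subset_integral => //.
- exact: measurableT.
- by move=> t _; rewrite lee_fin.
Qed.

Lemma measurable_slice_card (sbar : nat) delta :
  measurable (slice [set dt | (sbar < dl0norm dt.1)%N] delta).
Proof.
rewrite [X in measurable X]
  (_ : _ = if (sbar < dl0norm delta)%N then setT else set0).
  by case: ifP.
by apply/seteqP; split => t /=; case: ifP.
Qed.

Lemma measurable_slice_setCB C C1 eps thetas sbar delta :
  measurable (slice (~` Bset C C1 rho0 eps thetas sbar) delta).
Proof.
rewrite [X in measurable X](_ : _ = ~` (if (dl0norm delta <= sbar)%N then
   ([set t | (l2norm (vmask delta (row_of_tuple t) - thetas))%:E <=
      C%:E * eps]%E
   `&` [set t | (l2norm (row_of_tuple t - vmask delta (row_of_tuple t)))%:E <=
      (Num.sqrt ((1 + C1) * rho0^-1 * p%:R))%:E]%E) else set0)); last first.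
  apply/seteqP; split => t /= h; apply: contra_not h.
    by case: ifP => // ds [h1 h2]; exists delta.
  by move=> [d' /= ds [dd [h1 h2]]]; rewrite dd ds.
apply: measurableC; case: ifP => // _; apply: measurableI.
- rewrite -[X in measurable X]setTI; apply: emeasurable_fun_infty_c => //.
  apply/measurable_EFinP; apply: measurable_l2norm => i.
  rewrite (_ : (fun t => _) =
     fun t : Rp => tnth t i * (delta i)%:R - thetas 0 i); last first.
    by apply/funext => t; rewrite !mxE.
  apply: measurable_funB => //; apply: measurable_funM => //.
  exact: measurable_tnth.
- rewrite -[X in measurable X]setTI; apply: emeasurable_fun_infty_c => //.
  by apply/measurable_EFinP; exact: measurable_outer_l2norm.
Qed.

Lemma measurable_quasi_posterior A :
  (forall delta, measurable (slice A delta)) ->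
  measurable_fun [set: Zs] (fun z => quasi_posterior ell rho0 rho1 omega z A).
Proof.
move=> mA; apply: measurable_funM.
  apply: (measurableT_comp (fine_measurable measurableT)).
  exact: measurable_quasi_mass.
under eq_fun do rewrite -powR_inv1 ?fine_ge0 ?quasi_mass_ge0//.
apply: (measurableT_comp (@measurable_powR R (-1))).
apply: (measurableT_comp (fine_measurable measurableT)).
by apply: measurable_quasi_mass => // delta; exact: measurableT.
Qed.

(** The real number [y] stands for [C * eps], which may be infinite. *)
Lemma quasi_posterior_setCB_le z thetas (C C1 u rhob kappab y : R) (r : R -> R)
    (sbar : nat) :
  let eps := contraction_radius r rhob (l0norm thetas) sbar in
  let a := rhob * Num.sqrt (l0norm thetas + sbar)%:R in
  1 <= C -> 7 <= C1 -> 0 < u -> 0 < rhob -> 0 < kappab ->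
  (0 < p)%N -> q / (1 - q) = 1 / (p%:R `^ (u + 1)) ->
  32 * rho1 * linfnorm thetas <= rhob ->
  event1 ell rho0 rho1 omega thetas rhob kappab r sbar z ->
  (y%:E <= C%:E * eps)%E ->
  32 * ((1 + u) * (l0norm thetas)%:R * ln (p%:R + p%:R * kappab / rho1))
    <= a * y ->
  quasi_posterior ell rho0 rho1 omega z (~` Bset C C1 rho0 eps thetas sbar) <=
  quasi_posterior ell rho0 rho1 omega z [set dt | (sbar < dl0norm dt.1)%N] +
  8 * expR (- (a * y / 32)) + expR (- p%:R).
Proof.
move=> eps a C1' C17 u0 rhob0 kappab0 p0 qE hth [[wd hg hk] hr] hy hmax.
have eps0 : (0 <= eps)%E by exact: contraction_radius_ge0.
have a0 : 0 <= a by rewrite mulr_ge0 ?sqrtr_ge0// ltW.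
set B := ~` _; set big := [set dt | _].
pose E0 := ell thetas z - rho1 / 2 * l2norm thetas ^+ 2.
pose K := expR (E0 - 15 / 32 * (a * y)).
have K0 : 0 <= K by exact: expR_ge0.
have mB delta : measurable (slice B delta) by exact: measurable_slice_setCB.
have mbig delta : measurable (slice big delta) by exact: measurable_slice_card.
(* Large models are charged entirely to [big], small ones to [K] and the
   Gaussian tail; adding both bounds gives one inequality valid for all. *)
have slice_le delta :
    (\int[lebesgue_tuple R p]_(t in slice B delta)
       (dens z delta (row_of_tuple t))%:E <=
     \int[lebesgue_tuple R p]_(t in slice big delta)
       (dens z delta (row_of_tuple t))%:E +
     ((omega delta * K)%:E + (expR (- p%:R))%:E *
      \int[lebesgue_tuple R p]_t (dens z delta (row_of_tuple t))%:E))%E.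
  have I0 (S : set Rp) : (0 <= \int[lebesgue_tuple R p]_(t in S)
       (dens z delta (row_of_tuple t))%:E)%E.
    by apply: integral_ge0 => t _; rewrite lee_fin.
  have [ds|ds] := leqP (dl0norm delta) sbar; last first.
    apply: (@le_trans _ _ (\int[lebesgue_tuple R p]_(t in slice big delta)
       (dens z delta (row_of_tuple t))%:E)%E).
      apply: ge0_subset_integral => //.
      - exact: measurable_funS (mdens z delta).
      - by move=> t _; rewrite lee_fin.
    rewrite leeDl// adde_ge0 ?mule_ge0 ?lee_fin ?expR_ge0//.
    by rewrite mulr_ge0.
  apply: (@le_trans _ _ ((omega delta * K)%:E + (expR (- p%:R))%:E *
      \int[lebesgue_tuple R p]_t (dens z delta (row_of_tuple t))%:E)%E);
    last by rewrite leeDr.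
  apply: (@quasi_slice_le R p dZ Zs ell rho0 rho1 omega mell rho0_gt0 rho1_gt0
    omega_ge0 z delta _ _ C1
    (fun i => if delta i then thetas 0 i else 0)) => //.
    by rewrite mulr_ge0.
  move=> t Bt.
  have [inner|inner] := leP
    (l2norm (row_of_tuple t - vmask delta (row_of_tuple t)))
    (Num.sqrt ((1 + C1) * rho0^-1 * p%:R)); last by right.
  left.
  set x := l2norm (vmask delta (row_of_tuple t) - thetas).
  have far : (C%:E * eps < x%:E)%E.
    by rewrite ltNge; apply/negP => close; apply: Bt; exists delta.
  have yx : y <= x by rewrite -lee_fin (le_trans hy)// ltW.
  have epsx : (eps < x%:E)%E by rewrite (le_lt_trans _ far)// lee_pemull.
  have hm : (l0norm thetas + dl0norm delta <= l0norm thetas + sbar)%N.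
    by rewrite leq_add2l.
  have hb : bregman ell thetas (vmask delta (row_of_tuple t)) z
      <= - (1 / 2) * r x by apply: (hr delta) => //; exists (row_of_tuple t).
  have := @quasi_density_far R p dZ Zs ell rho0 rho1 omega
    rho0_gt0 rho1_gt0 omega_ge0 z delta thetas (row_of_tuple t) rhob (r x)
    _ rhob0 hm hg hth hb (rate_above_radius epsx).
  move=> /le_trans; apply.
  apply: ler_wpM2r.
    by apply: prodr_ge0 => i _; rewrite mulr_ge0 ?sqrtr_ge0 ?expR_ge0.
  apply: ler_wpM2l => //; rewrite ler_expR -/a -/x /E0.
  by have := ler_wpM2l a0 yx; lra.
have mass_le : (mass z B <=
    mass z big + (K%:E + (expR (- p%:R))%:E * mass z setT))%E.
  apply: (le_trans (lee_sum _ (fun delta _ => slice_le delta))).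
  rewrite big_split [X in (_ + X <= _)%E]big_split -ge0_sume_distrr; last first.
    by move=> delta _; apply: integral_ge0 => t _; rewrite lee_fin.
  by rewrite sumEFin -mulr_suml sum_bernoulli_prior mul1r.
have Tge := quasi_mass_ge mell rho0_gt0 rho1_gt0 omega_ge0 kappab0 hk.
rewrite /quasi_posterior.
have /andP[T0 Too] := wd.
have Tfin : mass z setT \is a fin_num by rewrite ge0_fin_numE// ltW.
have finA A : (forall delta, measurable (slice A delta)) ->
    mass z A \is a fin_num.
  move=> mA; rewrite ge0_fin_numE ?quasi_mass_ge0//.
  by rewrite (le_lt_trans (le_quasi_mass_setT z mA)).
move: mass_le Tge T0.
rewrite -(fineK (finA _ mB)) -(fineK (finA _ mbig)) -(fineK Tfin).
rewrite -EFinM -!EFinD !lee_fin lte_fin /=.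
set bB := fine _; set bb := fine _; set T := fine _ => mass_le Tge T0.
rewrite ler_pdivrMr// [leRHS]mulrDl [X in _ <= X + _]mulrDl divfK ?gt_eqF//.
apply: (le_trans mass_le); rewrite addrA lerD2r lerD2l.
apply: (@le_trans _ _ (8 * expR (- (a * y / 32)) * (omega (vsupport thetas) *
   expR E0 * Num.sqrt (rho1 / (kappab + rho1)) ^+ l0norm thetas))); last first.
  by rewrite ler_wpM2l// mulr_ge0 ?expR_ge0.
rewrite /K expRD [omega _ * _ * _]mulrAC [leRHS]mulrA [leRHS]mulrC.
rewrite ler_wpM2l ?expR_ge0//.
rewrite /bernoulli_prior dl0norm_vsupport.
exact: (far_weight_le (l0norm_le thetas) p0 u0).
Qed.

End posterior_contraction.

(** * Averaging over the observation *)

Lemma expectation_le_add (d : measure_display) (T : measurableType d)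
    (R : realType) (P : probability T R) (f g : T -> R) (c : \bar R) :
  measurable_fun [set: T] f -> measurable_fun [set: T] g ->
  (forall w, 0 <= f w) -> (forall w, 0 <= g w) -> (0 <= c)%E ->
  (forall w, (f w)%:E <= (g w)%:E + c)%E ->
  ('E_P[f] <= 'E_P[g] + c)%E.
Proof.
move=> mf mg f0 g0 c0 fg; rewrite unlock.
rewrite -[X in (_ <= _ + X)%E]mule1 -(@probability_setT _ _ _ P).
rewrite -integral_cst//.
rewrite -ge0_integralD//.
- apply: ge0_le_integral => //.
  + by move=> w _; rewrite lee_fin.
  + exact/measurable_EFinP.
  + by apply: emeasurable_funD => //; exact/measurable_EFinP.
- by move=> w _; rewrite lee_fin.
- exact/measurable_EFinP.
Qed.

Theorem theorem3 (R : realType) :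
  exists K1 : R, 3 <= K1 /\
  forall C C1 u : R, 3 <= C -> K1 <= C1 -> 0 < u ->
  exists p0 : nat, forall p : nat, (p0 <= p)%N ->
  forall (dZ : measure_display) (Zs : measurableType dZ)
    (dz : {sigma_finite_measure set Zs -> \bar R})
    (ell : 'rV[R]_p -> Zs -> R),
    measurable_fun [set: p.-tuple (measurableTypeR R) * Zs]
      (fun tz => ell (row_of_tuple tz.1) tz.2) ->
    (forall z, times_differentiable 3 (ell^~ z)) ->
  forall (dO : measure_display) (Omega : measurableType dO)
    (P : probability Omega R) (Z : {RV P >-> Zs}) (fstar : Zs -> R),
    measurable_fun [set: Zs] fstar ->
    (forall z, 0 <= fstar z) ->
    (forall A : set Zs, measurable A ->
      distribution P Z A = (\int[dz]_(z in A) (fstar z)%:E)%E) ->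
  forall (rho0 rho1 : R) (thetas : 'rV[R]_p) (rhob kappab q : R),
    0 < rho0 -> 0 < rho1 ->
    thetas != 0 ->
    0 < rhob -> 0 < kappab ->
    0 < q < 1 ->
    q / (1 - q) = 1 / (p%:R `^ (u + 1)) ->
    (9 <= p)%N ->
    2 * expR (2 * rho1) <= p%:R `^ (u / 2) ->
  let omega := bernoulli_prior (p := p) q in
  let Pi := quasi_posterior ell rho0 rho1 omega in
  let sstar := l0norm thetas in
    (0 < P (Z @^-1` event0 ell rho0 rho1 omega thetas rhob kappab))%E ->
    32 * rho1 * linfnorm thetas <= rhob ->
  forall (sbar : nat) (r : R -> R) (E : set Zs),
    (sstar <= sbar)%N ->
    rate_function r ->
    measurable E ->
    E `<=` event1 ell rho0 rho1 omega thetas rhob kappab r sbar ->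
  let eps := contraction_radius r rhob sstar sbar in
  let B := Bset C C1 rho0 eps thetas sbar in
    ((32 * Num.max (sbar%:R * ln p%:R)
                   ((1 + u) * sstar%:R * ln (p%:R + p%:R * kappab / rho1)))%:E
      <= (C * rhob * Num.sqrt (sstar + sbar)%:R)%:E * eps)%E ->
    ('E_P[(fun w => \1_E (Z w) * Pi (Z w) (~` B))%R]
      <= 'E_P[(fun w => \1_E (Z w) *
                Pi (Z w) [set dt | (sbar < dl0norm dt.1)%N])%R]
         + 8%:E * expeR (- ((C / 32 * rhob * Num.sqrt (sstar + sbar)%:R)%:E * eps))
         + (2 * expR (- p%:R))%:E)%E.
Proof.
exists 7; split; first by lra.
move=> C C1 u C3 C17 u0; exists 0%N => p _ dZ Zs dz ell mell _.
move=> dO Omega P Z fstar _ _ _ rho0 rho1 thetas rhob kappab q.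
move=> rho0_gt0 rho1_gt0 thetas0 rhob0 kappab0 q01 qE p9 _ omega Pi sstar.
move=> _ hth sbar r E _ _ mE hE eps B hmax.
have p0 : (0 < p)%N by rewrite (leq_trans _ p9).
set m := (sstar + sbar)%N; set a := rhob * Num.sqrt m%:R.
set M := Num.max _ _ in hmax.
have eps0 : (0 <= eps)%E by exact: contraction_radius_ge0.
have C0 : 0 < C by lra.
have a_gt0 : 0 < a.
  rewrite mulr_gt0// sqrtr_gt0 ltr0n addn_gt0; apply/orP; left.
  apply/card_gt0P; have [i ti] : exists i, thetas 0 i != 0.
    apply/existsP; rewrite -negb_forall; apply: contra thetas0 => /forallP t0.
    by apply/eqP/rowP => i; rewrite mxE; exact/eqP/t0.
  by exists i.
have hM : (1 + u) * sstar%:R * ln (p%:R + p%:R * kappab / rho1) <= M.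
  by rewrite le_max lexx orbT.
set c1 := (8%:E * _)%E; set c2 := (_)%:E.
have c1_ge0 : (0 <= c1)%E by rewrite mule_ge0// ?lee_fin// expeR_ge0.
have c2_ge0 : (0 <= c2)%E by rewrite lee_fin mulr_ge0// expR_ge0.
pose big : set ({ffun 'I_p -> bool} * 'rV[R]_p) :=
  [set dt | (sbar < dl0norm dt.1)%N].
have bound z : E z -> ((Pi z (~` B))%:E <= (Pi z big)%:E + (c1 + c2))%E.
  move=> Ez.
  have main y : (y%:E <= C%:E * eps)%E -> 32 * M <= a * y ->
      Pi z (~` B) <= Pi z big + 8 * expR (- (a * y / 32)) + expR (- p%:R).
    move=> hy hay.
    apply: (quasi_posterior_setCB_le mell rho0_gt0 rho1_gt0 q01 _ C17 u0 rhob0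
      kappab0 p0 qE hth (hE z Ez) hy); first by lra.
    by apply: le_trans hay; rewrite ler_pM2l//; lra.
  have ep0 : 0 <= expR (- p%:R) :> R by exact: expR_ge0.
  case epsE : eps eps0 => [e| |] // e0.
    apply: (@le_trans _ _ ((Pi z big)%:E +
      ((8 * expR (- (a * (C * e) / 32)))%:E + (expR (- p%:R))%:E))%E).
      rewrite -!EFinD lee_fin addrA; apply: main; first by rewrite epsE.
      by move: hmax; rewrite epsE -EFinM lee_fin /a; lra.
    rewrite leeD2l// leeD//.
      rewrite /c1 epsE -EFinM /= lee_fin ler_pM2l// ler_expR /a.
      by rewrite le_eqVlt; apply/orP; left; apply/eqP; field.
    by rewrite lee_fin; lra.
  (* For infinite [eps], take [y := Y / a] so large that the exponential term is
     below the second copy of [exp (- p)]. *)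
  pose Y := Num.max (32 * M) (32 * (p%:R + ln 8)).
  have aY : a * (Y / a) = Y by rewrite mulrC divfK// gt_eqF.
  have := main (Y / a); rewrite aY epsE gt0_muley ?lte_fin// leey => /(_ isT).
  rewrite le_max lexx => /(_ isT) hP.
  have Y8 : 8 * expR (- (Y / 32)) <= expR (- p%:R).
    apply: (@le_trans _ _ (8 * expR (- (p%:R + ln 8)))).
      rewrite ler_pM2l// ler_expR lerN2 ler_pdivlMr// mulrC.
      by rewrite le_max lexx orbT.
    by rewrite opprD expRD [expR (- ln 8)]expRN lnK ?posrE// mulrC divfK.
  apply: (@le_trans _ _ ((Pi z big)%:E + c2)%E).
    by rewrite -EFinD lee_fin; lra.
  by rewrite leeD2l// leeDr.
have mB delta : measurable [set t | (~` B) (delta, row_of_tuple t)].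
  exact: measurable_slice_setCB.
have mbig delta : measurable
    [set t : p.-tuple (measurableTypeR R) | big (delta, row_of_tuple t)].
  exact: measurable_slice_card.
have Pi_ge0 z A : 0 <= Pi z A.
  by rewrite divr_ge0// fine_ge0// quasi_mass_ge0.
have mPi A : (forall delta, measurable
    [set t : p.-tuple (measurableTypeR R) | A (delta, row_of_tuple t)]) ->
    measurable_fun [set: Omega] (fun w => \1_E (Z w) * Pi (Z w) A).
  move=> mA.
  apply: (measurableT_comp (f := fun z => \1_E z * Pi z A)) => //.
  by apply: measurable_funM => //; exact: measurable_quasi_posterior.
rewrite -addeA; apply: expectation_le_add.
- exact: mPi.
- exact: mPi.
- by move=> w; rewrite mulr_ge0.
- by move=> w; rewrite mulr_ge0.
- by rewrite adde_ge0.
move=> w; rewrite indicE; have [wE|wE] := boolP (Z w \in E).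
  by rewrite !mul1r; apply: bound; rewrite -inE.
by rewrite !mul0r add0e adde_ge0.
Qed.
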